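(* Let $(v_n)_{n=1}^\infty$ be a sequence in the unit circle $S^1\subset\mathbb{R}^2$ such that $D=\{v_n:n\in\mathbb{N}\}$ is dense in $S^1$ and such that for each $v\in D$ and each $N\ge 1$ there exists $n\ge N$ with $v_{n+1}=v_{n+2}=\dots=v_{n+N}=v$. Let $P\subset\mathbb{R}^2$ be the set constructed from $(v_n)$ by the construction described in the context. Then $P$ is lower porous in $\mathbb{R}^2$.
   Context: $\mathbb{R}^2$ carries the Euclidean norm $\|\cdot\|$; $B(x,r)$ is the open ball of centre $x$ and radius $r$. For non-empty $A\subset\mathbb{R}^2$ put $d(x,A)=\inf\{\|x-y\|:y\in A\}$ and, for $r>0$, $B(A,r)=\{x\in\mathbb{R}^2:d(x,A)<r\}$; also $B(\varnothing,r)=\varnothing$. For $v=(v_1,v_2)\in\mathbb{R}^2$ let $v^\bot=(-v_2,v_1)$. Construction of $P$ from the sequence $(v_n)$: for $n\in\mathbb{N}$, $k\in\mathbb{Z}$ let $L_n^k=\{(k/2^{6n})v_n^\bot+tv_n:t\in\mathbb{R}\}$. Put $H_0=\varnothing$ and, for $n\ge1$, $$C_n=\Big(\bigcup_{k=-\infty}^{\infty}L_n^k\Big)\setminus B(H_{n-1},1/2^{6n}),\qquad H_n=H_{n-1}\cup\bigcup_{x\in C_n}B(x,1/2^{6(n+1)}).$$ Let $H=\bigcup_{n=1}^\infty H_n$ and $P=\mathbb{R}^2\setminus H$. Lower porosity: a subset $Q$ of a metric space $M$ is lower porous at $x\in Q$ if there exist $\rho>0$ and $r_0>0$ such that for every $0<r<r_0$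 there exists $y\in M$ with $d(x,y)<r$ and $B(y,\rho r)\cap Q=\varnothing$. $Q$ is lower porous if it is lower porous at each of its points. *)

(* Defs.v *)
From HB Require Import structures.
From mathcomp Require Import all_boot all_order all_algebra.
From mathcomp Require Import all_classical all_reals all_analysis.
From mathcomp Require Import ring lra.

Set Implicit Arguments.
Unset Strict Implicit.
Unset Printing Implicit Defensive.

Import Order.TTheory GRing.Theory Num.Theory.
Import numFieldNormedType.Exports.

Local Open Scope classical_set_scope.
Local Open Scope ring_scope.

(* The library norms [R * R] with the sup norm; [plane R] is an alias of
   [R * R] carrying the Euclidean norm, and its ball, topology and distance. *)
Definition plane (R : realType) : Type := (R * R)%type.

HB.instance Definition _ (R : realType) :=
  GRing.Lmodule.copy (plane R) (R * R)%type.

Definition enorm (R : realType) (x : plane R) : R :=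
  Num.sqrt (x.1 ^+ 2 + x.2 ^+ 2).

Lemma enormD (R : realType) (x y : plane R) :
  enorm (x + y) <= enorm x + enorm y.
Proof.
rewrite /enorm -[(x + y).1]/(x.1 + y.1) -[(x + y).2]/(x.2 + y.2).
have sx : 0 <= x.1 ^+ 2 + x.2 ^+ 2 by rewrite addr_ge0 ?sqr_ge0.
have sy : 0 <= y.1 ^+ 2 + y.2 ^+ 2 by rewrite addr_ge0 ?sqr_ge0.
have hs : 0 <= Num.sqrt (x.1 ^+ 2 + x.2 ^+ 2) + Num.sqrt (y.1 ^+ 2 + y.2 ^+ 2).
  by rewrite addr_ge0 ?sqrtr_ge0.
rewrite -[leRHS]ger0_norm// -sqrtr_sqr ler_wsqrtr//.
rewrite [leRHS]sqrrD !sqr_sqrtr//.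
have cs : x.1 * y.1 + x.2 * y.2 <=
    Num.sqrt (x.1 ^+ 2 + x.2 ^+ 2) * Num.sqrt (y.1 ^+ 2 + y.2 ^+ 2).
  rewrite -sqrtrM// (le_trans (ler_norm _))// -sqrtr_sqr ler_wsqrtr//.
  rewrite -subr_ge0.
  rewrite [leRHS](_ : _ = (x.1 * y.2 - x.2 * y.1) ^+ 2); last by ring.
  exact: sqr_ge0.
by move: cs; lra.
Qed.

Lemma enormZ (R : realType) (l : R) (x : plane R) :
  enorm (l *: x) = `|l| * enorm x.
Proof.
rewrite /enorm -[(l *: x).1]/(l * x.1) -[(l *: x).2]/(l * x.2).
by rewrite !exprMn -mulrDr sqrtrM ?sqr_ge0// sqrtr_sqr.
Qed.

Lemma enorm0_eq0 (R : realType) (x : plane R) : enorm x = 0 -> x = 0.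
Proof.
move/eqP; rewrite /enorm sqrtr_eq0 => h.
have : x.1 ^+ 2 + x.2 ^+ 2 == 0.
  by rewrite eq_le h addr_ge0 ?sqr_ge0.
rewrite paddr_eq0 ?sqr_ge0// !sqrf_eq0.
by case: x {h} => a b /= /andP[/eqP-> /eqP->].
Qed.

HB.instance Definition _ (R : realType) :=
  Lmodule_isNormed.Build R (plane R)
    (@enormD R) (@enormZ R) (@enorm0_eq0 R).

Definition plane_dist (R : realType) (x y : plane R) : R := `|x - y|.

Lemma plane_dist_ge0 (R : realType) (x y : plane R) : 0 <= plane_dist x y.
Proof. exact: normr_ge0. Qed.

Lemma plane_dist_eq0 (R : realType) (x y : plane R) : plane_dist x y = 0 -> x = y.
Proof. by move/normr0_eq0/eqP; rewrite subr_eq0 => /eqP. Qed.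

Lemma ball_plane_dist (R : realType) (x : plane R) (d : R) :
  ball x d = [set y | plane_dist x y < d].
Proof. by rewrite -ball_normE. Qed.

HB.instance Definition _ (R : realType) :=
  PseudoMetric_isMetric.Build R (plane R)
    (@plane_dist_ge0 R) (@plane_dist_eq0 R) (@ball_plane_dist R).

Section metric.
Context {R : realType} {M : metricType R}.
Implicit Types (A Q : set M) (x y : M) (r : R).

Definition dist_to x A : R := inf [set mdist x y | y in A].

(* [inf set0 = 0] in the library, so [B(set0, r) = set0] needs [A !=set0]. *)
Definition set_ball A r : set M :=
  [set x | A !=set0 /\ dist_to x A < r].

Definition lower_porous_at Q x : Prop :=
  exists rho r0 : R, [/\ 0 < rho, 0 < r0 &
    forall r, 0 < r < r0 ->
      exists y, mdist x y < r /\ ball y (rho * r) `&` Q = set0].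

Definition lower_porous Q : Prop := forall x, Q x -> lower_porous_at Q x.

End metric.

Section construction.
Context {R : realType}.
Implicit Types (v : nat -> plane R) (n : nat) (k : int).

Definition unit_circle : set (plane R) := [set u | `|u| = 1].

Definition perp (u : plane R) : plane R := (- u.2, u.1).

Definition line v n k : set (plane R) :=
  [set (k%:~R / 2 ^+ (6 * n)) *: perp (v n) + t *: v n | t in [set: R]].

(* [C_n] as a function of [H' = H_{n-1}]. *)
Definition centers v n (H' : set (plane R)) : set (plane R) :=
  (\bigcup_(k in [set: int]) line v n k) `\` set_ball H' (1 / 2 ^+ (6 * n)).

(* [holes v n] is [H_n]; the value [v 0] is never used. *)
Fixpoint holes v n : set (plane R) :=
  if n is m.+1 then
    holes v m `|`
    \bigcup_(x in centers v m.+1 (holes v m)) ball x (1 / 2 ^+ (6 * m.+2))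
  else set0.

Definition P_set v : set (plane R) :=
  ~` \bigcup_(n in [set n | (1 <= n)%N]) holes v n.

(* [D = {v_n : n >= 1}]. *)
Definition directions v : set (plane R) :=
  [set v n | n in [set n | (1 <= n)%N]].

End construction.

(* Main.v *)
Require Import Defs.
From HB Require Import structures.
From mathcomp Require Import all_boot all_order all_algebra.
From mathcomp Require Import all_classical all_reals all_analysis.
From mathcomp Require Import ring lra.

(* At every point x (in P or not) and every stage n, some line of stage n
   passes within 2^(-6n) of x, at a point z say. Either z is a centre of a
   stage-n hole, of radius 2^(-6(n+1)), or z lies within 2^(-6n) of H_{n-1},
   which is a union of balls of radius at least 2^(-6n). Hence within distance
   3 * 2^(-6n) of x there is a ball of radius 2^(-6(n+1)) inside H_n; since
   consecutive scales have ratio 64, this gives porosity at every small r. *)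

Import Order.TTheory GRing.Theory Num.Theory.
Import numFieldNormedType.Exports.

Local Open Scope classical_set_scope.
Local Open Scope ring_scope.

(** The homothety with centre [h] and ratio [t = e / (2 s) < 1] maps [ball c s] onto a ball of
    radius [e / 2]; by convexity it stays inside [ball c s], because [h] does. *)
Lemma half_ball_near (R : realType) (V : normedModType R) (c h : V) (s e : R) :
  0 < e <= s -> `|c - h| < s ->
  exists y, `|h - y| < e / 2 /\ ball y (e / 2) `<=` ball c s.
Proof.
move=> /andP[e0 es] ch; have s0 : 0 < s by lra.
pose t := e / 2 / s; have ts : t * s = e / 2 by rewrite /t divfK// gt_eqF.
have t0 : 0 < t by rewrite !divr_gt0.
have t1 : t < 1 by rewrite /t ltr_pdivrMr//; lra.
exists (h + t *: (c - h)); split.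
  rewrite opprD addrA subrr sub0r normrN normrZ gtr0_norm//.
  by rewrite -ts ltr_pM2l.
move=> z; rewrite -!ball_normE /ball_/= => yz.
have -> : c - z = (1 - t) *: (c - h) + (h + t *: (c - h) - z).
  by rewrite scalerBl scale1r -(addrA c) -opprD addrA subrK.
rewrite (le_lt_trans (ler_normD _ _))// normrZ gtr0_norm ?subr_gt0//.
have : (1 - t) * `|c - h| < (1 - t) * s by rewrite ltr_pM2l ?subr_gt0.
by rewrite [ltRHS]mulrBl mul1r ts; lra.
Qed.

Lemma set_ball_dist (R : realType) (M : metricType R) (A : set M) (r : R) x :
  set_ball A r x -> exists2 y, A y & mdist x y < r.
Proof.
case=> -[a Aa] /inf_lt []; first by exists (mdist x a), a.
by move=> _ [y Ay <-] xy; exists y.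
Qed.

Lemma scaleS (R : realType) (n : nat) :
  1 / 2 ^+ (6 * n) = 64 * (1 / 2 ^+ (6 * n.+1)) :> R.
Proof.
have p0 : (2 : R) ^+ (6 * n) != 0 by rewrite expf_neq0.
by rewrite mulnS exprD; field.
Qed.

Lemma scale_gt0 (R : realType) (n : nat) : 0 < 1 / 2 ^+ (6 * n) :> R.
Proof. by rewrite divr_gt0// exprn_gt0. Qed.

(** A point of [holes v n] entered at some stage [m <= n], in a ball of radius
    [2^(-6(m+1)) >= 2^(-6(n+1))]. *)
Lemma holes_ball (R : realType) (v : nat -> plane R) n h : holes v n h ->
  exists c s, [/\ 1 / 2 ^+ (6 * n.+1) <= s, `|c - h| < s &
                  ball c s `<=` holes v n].
Proof.
elim: n h => [//|n IHn] h /= [/IHn[c [s [ns ch sub]]]|[c cC ch]].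
  exists c, s; split => //; last by move=> z /sub; left.
  by have := scaleS R n.+1; have := scale_gt0 R n.+2; lra.
exists c, (1 / 2 ^+ (6 * n.+2)); split => //.
by move=> z cz; right; exists c.
Qed.

(** In the orthonormal basis [perp (v n)], [v n], rounding the first coordinate of [x] down to a
    multiple of [e] moves [x] by less than [e]. *)
Lemma line_near (R : realType) (v : nat -> plane R) n x : unit_circle (v n) ->
  exists k z, line v n k z /\ `|x - z| < 1 / 2 ^+ (6 * n).
Proof.
rewrite /unit_circle /= => vn1; set e := 1 / _.
have e0 : 0 < e := scale_gt0 R n.
have v1 : (v n).1 ^+ 2 + (v n).2 ^+ 2 = 1.
  have := congr1 (fun t => t ^+ 2) vn1.
  by rewrite expr1n [`|_|]/(enorm (v n)) sqr_sqrtr// addr_ge0 ?sqr_ge0.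
have pn1 : `|perp (v n)| = 1.
  by rewrite [`|_|]/(enorm _) /enorm /= sqrrN addrC v1 sqrtr1.
pose a := x.2 * (v n).1 - x.1 * (v n).2.
pose b := x.1 * (v n).1 + x.2 * (v n).2.
have xE : x = a *: perp (v n) + b *: v n.
  apply/eqP; rewrite /eq_op /=; apply/andP; split; apply/eqP.
    (* Multiplying the left side by [|v n|^2 = 1] turns the goal into a polynomial identity. *)
    rewrite -[RHS]/(a * (- (v n).2) + b * (v n).1) -[LHS]mulr1 -v1 /a /b.
    by ring.
  rewrite -[RHS]/(a * (v n).1 + b * (v n).2) -[LHS]mulr1 -v1 /a /b.
  by ring.
pose k := Num.floor (a / e).
exists k, ((k%:~R / 2 ^+ (6 * n)) *: perp (v n) + b *: v n); split.
  by exists b.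
rewrite {1}xE opprD addrACA subrr addr0 -scalerBl normrZ pn1 mulr1.
have -> : k%:~R / 2 ^+ (6 * n) = k%:~R * e by rewrite /e mul1r.
have /andP[k1 k2] := floor_itv (a / e).
rewrite ler_pdivlMr// in k1; rewrite ltr_pdivrMr// intrD mulrDl mul1r in k2.
by rewrite ger0_norm; move: k1 k2; rewrite -/k; lra.
Qed.

Lemma hole_near (R : realType) (v : nat -> plane R) n x :
  unit_circle (v n.+1) ->
  exists y, `|x - y| < 3 * (1 / 2 ^+ (6 * n.+1)) /\
    ball y (1 / 2 ^+ (6 * n.+2)) `<=` holes v n.+1.
Proof.
move=> /(line_near _ _ _ x) [k [z [zk xz]]].
have eS := scaleS R n.+1; have e0 := scale_gt0 R n.+2.
have [zH|zH] :=
    pselect (set_ball (holes v n) (1 / 2 ^+ (6 * n.+1)) z); last first.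
  exists z; split; first by lra.
  by move=> w zw; right; exists z => //; split => //; exists k.
have [h Hh zh] := set_ball_dist _ _ _ _ _ zH.
have [c [s [ns ch sub]]] := holes_ball _ _ _ _ Hh.
have es : (0 : R) < 1 / 2 ^+ (6 * n.+1) <= s.
  by rewrite scale_gt0.
have [y [hy ysub]] := half_ball_near _ _ _ _ _ _ es ch.
exists y; split.
  have zh' : `|z - h| < 1 / 2 ^+ (6 * n.+1) := zh.
  (* With [e = 2^(-6(n+1))], the path from [x] via [z] and [h] to [y] is shorter than
     [e + e + e / 2 < 3 e]. *)
  have := ler_distD z x y; have := ler_distD h z y; lra.
move=> w yw; left; apply/sub/ysub.
by apply: le_ball yw; lra.
Qed.

Theorem theorem4p4 (R : realType) (v : nat -> plane R)
  (v_unit : forall n : nat, (1 <= n)%N -> unit_circle (v n))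
  (D_dense : unit_circle `<=` closure (directions v))
  (v_runs : forall u : plane R, directions v u ->
     forall N : nat, (1 <= N)%N ->
     exists n : nat, (N <= n)%N /\
       forall i : nat, (1 <= i <= N)%N -> v (n + i)%N = u) :
  lower_porous (P_set v).
Proof.
(* For the least [m] with [3 * 2^(-6m) <= r], minimality gives [r < 3 * 64 * 2^(-6m)], so
   [rho * r < 2^(-6(m+1))], the hole radius of stage [m]. *)
move=> x _; exists (1 / (3 * 64 * 64)), 1; split; rewrite ?divr_gt0 ?mulr_gt0//.
move=> r /andP[r0 r1].
have exn : exists n, (3 : R) * (1 / 2 ^+ (6 * n)) <= r.
  (* Here [3 / r < n <= 2^n <= 2^(6n)]. *)
  exists (Num.bound (3 / r)); set n := Num.bound _.
  have p0 : (0 : R) < 2 ^+ (6 * n) by rewrite exprn_gt0.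
  rewrite mulrA mulr1 ler_pdivrMr// mulrC -ler_pdivrMr//.
  have n0 : 3 / r < n%:R by rewrite archi_boundP// divr_ge0// ltW.
  rewrite (le_trans (ltW n0))// -natrX ler_nat.
  by rewrite (leq_trans (ltnW (ltn_expl n (isT : (1 < 2)%N))))//
    leq_exp2l// leq_pmull.
case: (ex_minnP exn) => -[|n] nr nmin.
  (* The least index is not [0]: that would give [3 <= r], against [r < 1]. *)
  by move: nr; rewrite muln0 expr0; lra.
have rn : r < (3 : R) * (1 / 2 ^+ (6 * n)).
  by rewrite ltNge; apply/negP => /nmin; rewrite ltnn.
have [y [xy ysub]] := hole_near _ _ n x (v_unit n.+1 isT).
exists y; split; first exact: lt_le_trans xy nr.
apply/seteqP; split => // z [yz]; apply.
exists n.+1 => //; apply: ysub; apply: le_ball yz.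
by move: rn; rewrite (scaleS R n) (scaleS R n.+1); lra.
Qed.
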